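(* Let $G$ be a finite group, $H$ a subgroup of $G$, and $S$ a symmetric subset of $G$ (i.e. $S=S^{-1}$) with $|S|=d$. Suppose no index two subgroup of $G$ acts transitively on the vertex set $H\backslash G$ of the Schreier graph $\mathrm{Sch}(G,H,S)$. Assume that the index of $H$ in $G$ is at least $4$, and that $S\cdot S$ contains its conjugates by the elements of $G$, i.e. $gxg^{-1}\in S\cdot S$ for all $x\in S\cdot S$ and $g\in G$. If the Schreier graph $\mathrm{Sch}(G,H,S)$ is connected, then the nontrivial spectrum of its normalised adjacency operator lies in the interval $$\left(-1+\frac{h_{\mathrm{Sch}}^4}{2^{12}d^8},\ 1-\frac{h_{\mathrm{Sch}}^2}{2d^2}\right],$$ where $h_{\mathrm{Sch}}$ denotes the vertex Cheeger constant of $\mathrm{Sch}(G,H,S)$.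
   Context: The Schreier graph $\mathrm{Sch}(G,H,S)$ has as vertex set the set $H\backslash G$ of right cosets of $H$ in $G$, with an edge from $Hg$ to $Hg'$ if $Hg'=Hgs$ for some $s\in S$. Edges are counted with multiplicity (one for each such $s\in S$), loops are allowed and each counts once towards the degree, so the graph is an undirected $d$-regular multi-graph. The group $G$ (and each of its subgroups) acts on $H\backslash G$ by $\tau\cdot Hg=Hg\tau^{-1}$. $S\cdot S=\{st: s,t\in S\}$. The normalised adjacency operator of a $d$-regular multi-graph is $\frac1d$ times its adjacency matrix (counting multiplicities). Its nontrivial spectrum is the set of its eigenvalues other than $1$ and $-1$. For a subset $V_1$ of the vertex set $V$, $N(V_1)$ is the set of vertices adjacent to some element of $V_1$, and $\partial(V_1)=N(V_1)\setminus V_1$. The vertex Cheeger constant is $$h=\inf\left\{\frac{|\partial(V_1)|}{|V_1|} : \emptyset\neq V_1\subseteq V,\ |V_1|\leq \frac{|V|}{2}\right\}.$$ *)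

(* Defs.v *)
From HB Require Import structures.
From mathcomp Require Import all_boot all_order all_algebra all_fingroup.
From mathcomp Require Import all_classical reals.
From mathcomp Require Import complex.

Set Implicit Arguments.
Unset Strict Implicit.
Unset Printing Implicit Defensive.

Import Order.TTheory GRing.Theory Num.Theory.
Local Open Scope classical_set_scope.
Local Open Scope ring_scope.

Section Multigraph.
(* A finite multigraph on V is given by its edge multiplicities m. *)
Variables (V : finType) (m : V -> V -> nat).

Definition adjacent : rel V := fun v w => (0 < m v w)%N.

Definition graph_connected : Prop := forall v w : V, connect adjacent v w.

Definition nbhd (A : {set V}) : {set V} :=
  [set w | [exists v in A, adjacent v w]]%SET.

Definition vboundary (A : {set V}) : {set V} := (nbhd A :\: A)%SET.

Definition vertex_cheeger (R : realType) : R :=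
  inf [set (#|vboundary A|%:R / #|A|%:R : R) | A in
        [set A : {set V} | A != finset.set0 /\ #|A|%:R <= #|V|%:R / 2 :> R]].

Definition normalised_adjacency (F : fieldType) (d : nat) : 'M[F]_#|V| :=
  d%:R^-1 *: \matrix_(i, j) (m (enum_val i) (enum_val j))%:R.

End Multigraph.

Definition nontrivial_spectrum (F : fieldType) (n : nat) (A : 'M[F]_n) : set F :=
  [set lam | [/\ eigenvalue A lam, lam != 1 & lam != -1]].

Section Schreier.
Variables (gT : finGroupType) (G H : {group gT}).

Definition sch_vertex : finType := {v : {set gT} | v \in rcosets H G}.

Definition sch_mult (S : {set gT}) (v w : sch_vertex) : nat :=
  #|[set s in S | val w == (val v :* s)%g]%SET|.

(* The left action tau . Hg = H g tau^-1, restricted to a subgroup K; MathComp's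
   actions are right actions. *)
Definition acts_transitively (K : {group gT}) : Prop :=
  forall v w : sch_vertex, exists2 tau, tau \in K & val w = (val v :* tau^-1)%g.

End Schreier.

(* Main.v *)
Require Import Defs.
From HB Require Import structures.
From mathcomp Require Import all_boot all_order all_algebra all_fingroup.
From mathcomp Require Import all_classical reals.
From mathcomp Require Import complex.
From mathcomp Require Import ring lra zify.

(** Write d for the degree, n for the number of vertices and h for the vertex
Cheeger constant.

Upper bound.  The vertex boundary of a set is at most its edge boundary, so the
classical Cheeger argument (coarea formula for the squares of the two parts of a
function cut at its median, then Young's inequality) gives the Poincare
inequality of [cheeger_poincare]: every function g is within d/h^2 times its
Dirichlet energy of a constant, in squared norm.  For an eigenfunction
orthogonal to the constants this is the bound x <= 1 - h^2/(2 d^2)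
([cheeger_eigenvalue_le]).

Lower bound.  Let f be an eigenfunction with eigenvalue x within
h^4/(2^12 d^8) of -1.  Then f(vs) is close to - f(v) for every s in S, so |f|
has little energy, and the Poincare inequality makes |f| almost a constant c.
Consequently f is almost c times a sign: the set A of the vertices where f is
nonnegative has about n/2 elements, and every s in S moves almost all of A to
the complement of A ([card_nonneg_half], [card_same_sign_le]).

Now A is almost invariant under S.S, and since S.S is closed under conjugation,
so is every translate of A by G, hence also the intersection X of A with a
translate.  For r in S the sets X :|: Xr and X :&: Xr are then almost invariant
under S itself, so expansion makes each of them almost empty or almost full.
As the sum of their sizes is 2|X|, the set X is either tiny or of size at least
about n/2 ([translate_dichotomy]).  So each translate of A is almost A or almost
its complement, and the elements of G of the first kind form a subgroup K of
index two, disjoint from S ([translate_index2], [alternating_index2]).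

By hypothesis K is not transitive on the cosets, which forces H to lie in K
([intransitive_index2_sub]); hence the cosets inside K and those outside K are a
bipartition of the graph.  Changing the sign of f on one side produces an
eigenfunction with eigenvalue -x, and the upper bound applied to -x
contradicts the closeness of x to -1. *)

Set Implicit Arguments.
Unset Strict Implicit.
Unset Printing Implicit Defensive.

Import Order.TTheory GRing.Theory Num.Theory.
Local Open Scope classical_set_scope.
Local Open Scope ring_scope.
Local Open Scope complex_scope.

(** * The Poincare inequality from the vertex Cheeger constant *)

Lemma pos_neg_parts_cases (R : realDomainType) (x : R) :
  (0 <= x /\ Num.max x 0 = x /\ Num.max (- x) 0 = 0) \/
  (x <= 0 /\ Num.max x 0 = 0 /\ Num.max (- x) 0 = - x).
Proof.
have /orP[x0|x0] := le_total 0 x; [left | right]; split=> //.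
  by rewrite max_l // max_r ?oppr_le0.
by rewrite max_r // max_l ?oppr_ge0.
Qed.

Lemma sqr_dist_parts_le (R : realDomainType) (x y : R) :
  (Num.max x 0 - Num.max y 0) ^+ 2 + (Num.max (- x) 0 - Num.max (- y) 0) ^+ 2 <=
  (x - y) ^+ 2.
Proof.
by case: (pos_neg_parts_cases x) => -[x0 [-> ->]];
  case: (pos_neg_parts_cases y) => -[y0 [-> ->]]; nra.
Qed.

Section Cheeger.
Variables (R : realType) (V : finType) (m : V -> V -> nat).

Lemma vertex_cheeger_boundary (A : {set V}) : (2 * #|A| <= #|V|)%N ->
  vertex_cheeger m R * #|A|%:R <= #|vboundary m A|%:R.
Proof.
move=> A_half; have [->|A0] := eqVneq A finset.set0.
  by rewrite finset.cards0 mulr0.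
have cA : 0 < #|A|%:R :> R by rewrite ltr0n card_gt0.
rewrite -ler_pdivlMr //; apply: ge_inf.
  by exists 0 => _ [B _ <-]; rewrite divr_ge0.
exists A => //; split=> //.
by rewrite ler_pdivlMr // -natrM ler_nat mulnC.
Qed.

Lemma card_vboundary_le (A : {set V}) :
  (#|vboundary m A| <= \sum_(v in A) \sum_(w in ~: A) m v w)%N.
Proof.
rewrite exchange_big /= -sum1_card.
have sub w : w \in vboundary m A -> (w \in ~: A)%SET.
  by rewrite !inE => /andP[].
rewrite [leqRHS](bigID (mem (vboundary m A))) /=.
rewrite [X in (_ <= X + _)%N](eq_bigl (mem (vboundary m A))); last first.
  by move=> w; apply/andP/idP => [[]//|/= wA]; rewrite sub.
apply: leq_trans (leq_addr _ _); apply: leq_sum => w.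
rewrite !inE => /andP[_ /existsP[v /andP[vA mvw]]].
by rewrite (bigD1 v) //= (leq_trans mvw) // leq_addr.
Qed.

(** Induction on the support: peel off the layer of height t, the least positive
value of [phi], over the support A.  The layer contributes to the right-hand
side t times the number of edges leaving A, which is at least t times the size
of the vertex boundary. *)
Lemma cheeger_coarea (phi : V -> R) :
    (forall v, 0 <= phi v) -> (2 * #|[set v | (0 < phi v)%R]%SET| <= #|V|)%N ->
  vertex_cheeger m R * \sum_v phi v <=
  \sum_v \sum_w (m v w)%:R * Num.max (phi v - phi w) 0.
Proof.
have [k] := ubnP #|[set v | 0 < phi v]%SET|.
elim: k phi => // k IHk phi; set A := [set v | 0 < phi v]%SET => Ak phi_ge0 A_half.
have phiN v : v \notin A -> phi v = 0.
  by rewrite inE -leNgt => phi_le0; apply/eqP; rewrite eq_le phi_le0 phi_ge0.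
have [A0|[v1 Av1]] := finset.set_0Vmem A.
  rewrite big1 => [|v _]; last by rewrite phiN // A0 finset.in_set0.
  by rewrite mulr0; do 2!apply: sumr_ge0 => ? _; rewrite mulr_ge0 // le_max lexx orbT.
case: (arg_minP phi Av1) => v0 Av0 min_v0; set t := phi v0.
pose psi v := if v \in A then phi v - t else 0.
have {}Av0 : v0 \in A := Av0.
have t_gt0 : 0 < t by move: Av0; rewrite inE.
have psi_ge0 v : 0 <= psi v.
  by rewrite /psi; case: ifP => // /min_v0; rewrite subr_ge0.
have psi_supp : [set v | 0 < psi v]%SET \subset (A :\ v0)%SET.
  apply/fintype.subsetP => v; rewrite !inE /psi; case: eqP => [->|_] /=.
    by rewrite Av0 subrr ltxx.
  by case: ifP => [|_]; rewrite ?inE // ltxx.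
have card_supp := subset_leq_card psi_supp.
have A_D1 : (#|A| = #|A :\ v0|%SET.+1)%N by rewrite (cardsD1 v0) Av0.
have {}IHk := IHk psi _ psi_ge0 _.
have split_phi v : phi v = t * (v \in A)%:R + psi v.
  rewrite /psi; case: ifPn => [_|/phiN->]; first by rewrite mulr1 addrC subrK.
  by rewrite mulr0 addr0.
have split_max v w : Num.max (phi v - phi w) 0 =
    t * ((v \in A) && (w \notin A))%:R + Num.max (psi v - psi w) 0.
  have := psi_ge0 v; have := psi_ge0 w; rewrite /psi.
  have [vA|/phiN v0'] := boolP (v \in A); have [wA|/phiN w0] := boolP (w \in A);
    rewrite /= ?v0' ?w0 ?mulr0 ?mulr1 ?add0r => w_ge0 v_ge0.
  - by congr Num.max; ring.
  - by rewrite !subr0 !max_l ?phi_ge0 // addrC subrK.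
  - by rewrite !max_r ?sub0r ?oppr_le0 ?phi_ge0.
  by [].
under eq_bigr do rewrite split_phi.
rewrite big_split /= -mulr_sumr mulrDr.
under [leRHS]eq_bigr => v _.
  under eq_bigr do rewrite split_max mulrDr.
  rewrite big_split /=; over.
rewrite big_split /= lerD //; last by apply: IHk; lia.
have -> : \sum_v (v \in A)%:R = #|A|%:R :> R.
  by rewrite -sum1_card natr_sum [RHS]big_mkcond /=; apply: eq_bigr => v _; case: (v \in A).
have -> : \sum_v \sum_w (m v w)%:R * (t * ((v \in A) && (w \notin A))%:R) =
    t * (\sum_(v in A) \sum_(w in ~: A) m v w)%N%:R.
  rewrite natr_sum [in RHS]big_mkcond mulr_sumr; apply: eq_bigr => v _ /=.
  case: (v \in A) => /=; last by rewrite mulr0 big1 // => w _; rewrite !mulr0.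
  rewrite natr_sum [in RHS]big_mkcond mulr_sumr; apply: eq_bigr => w _ /=.
  by rewrite finset.in_setC; case: (w \in A); rewrite /= ?mulr0 ?mulr1 // mulrC.
rewrite mulrCA ler_pM2l // (le_trans (vertex_cheeger_boundary A_half)) //.
by rewrite ler_nat card_vboundary_le.
Qed.

(** The level set at a median splits a function into two parts, each supported
on at most half of the vertices, to which the coarea inequality applies. *)
Lemma exists_median (g : V -> R) : (0 < #|V|)%N -> exists c,
  (2 * #|[set v | (c < g v)%R]%SET| <= #|V|)%N /\
  (2 * #|[set v | (g v < c)%R]%SET| <= #|V|)%N.
Proof.
case/card_gt0P => u _.
pose above v := [set w | (g v < g w)%R]%SET.
pose P v := (2 * #|above v| <= #|V|)%N.
case: (@arg_maxP _ _ _ u xpredT g isT) => w _ w_max.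
have Pw : P w.
  rewrite /P (_ : above w = finset.set0) ?finset.cards0 //.
  by apply/finset.setP => v; rewrite !inE; apply/negbTE; rewrite -leNgt; apply: w_max.
case: (arg_minP g Pw) => c Pc c_min; exists (g c); split=> //.
set B := [set v | (g v < g c)%R]%SET.
have [->|[b1 Bb1]] := finset.set_0Vmem B; first by rewrite finset.cards0.
case: (arg_maxP g Bb1) => b Bb b_max.
have {Bb} bc : g b < g c by have : b \in B := Bb; rewrite inE.
have : ~~ P b by apply: contraTN bc => /c_min; rewrite leNgt.
suff aboveE : above b = (~: B)%SET by rewrite /P aboveE; have := cardsC B; lia.
apply/finset.setP => v; rewrite !inE -leNgt; apply/idP/idP => [bv|]; last first.
  exact: lt_le_trans.
rewrite leNgt; apply/negP => vc; have vB : v \in B by rewrite inE.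
have gvb : g v <= g b := b_max v vB.
by rewrite leNgt bv in gvb.
Qed.

Hypothesis msym : forall v w, m v w = m w v.
Variable d : nat.
Hypothesis mreg : forall v, (\sum_w m v w)%N = d.

Let h : R := vertex_cheeger m R.

Lemma vertex_cheeger_ge0 : (1 < #|V|)%N -> 0 <= h.
Proof.
move=> V_gt1; apply: lb_le_inf => [|_ [A _ <-]]; last by rewrite divr_ge0.
have /card_gt0P[v _] : (0 < #|V|)%N by rewrite ltnW.
exists (#|vboundary m [set v]%SET|%:R / #|[set v]%SET|%:R), [set v]%SET => //=.
split; first by apply/set0Pn; exists v; rewrite inE.
by rewrite cards1 ler_pdivlMr // -natrM ler_nat.
Qed.

Lemma sum_edges_source (g : V -> R) :
  \sum_v \sum_w (m v w)%:R * g v = d%:R * \sum_v g v.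
Proof.
rewrite mulr_sumr; apply: eq_bigr => v _.
by rewrite -mulr_suml -natr_sum mreg.
Qed.

Lemma sum_edges_target (g : V -> R) :
  \sum_v \sum_w (m v w)%:R * g w = d%:R * \sum_v g v.
Proof.
rewrite -sum_edges_source exchange_big; apply: eq_bigr => v _.
by apply: eq_bigr => w _; rewrite msym.
Qed.

(** Coarea for g^2, whose variation along an edge is |g v - g w||g v + g w|.
Young's inequality with the weights h^2 and 4 d^2 replaces the Cauchy-Schwarz
step of the usual argument and lands on the constant h^2/d at once. *)
Lemma dirichlet_half_support (g : V -> R) : (0 < d)%N -> 0 <= h ->
    (forall v, 0 <= g v) -> (2 * #|[set v | (0 < g v)%R]%SET| <= #|V|)%N ->
  h ^+ 2 * \sum_v g v ^+ 2 <=
  d%:R * \sum_v \sum_w (m v w)%:R * (g v - g w) ^+ 2.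
Proof.
move=> d_gt0 h_ge0 g_ge0 g_supp.
set F := (X in _ * X <= _); set E := (X in _ <= _ * X).
have dR : 0 < d%:R :> R by rewrite ltr0n.
pose T := \sum_v \sum_w (m v w)%:R * Num.max (g v ^+ 2 - g w ^+ 2) 0.
have coarea : h * F <= T.
  apply: (@cheeger_coarea (fun v => g v ^+ 2)) => [v|]; first exact: sqr_ge0.
  rewrite (_ : [set v | _]%SET = [set v | (0 < g v)%R]%SET) //.
  by apply/finset.setP => v; rewrite !inE !lt_def sqr_ge0 g_ge0 sqrf_eq0.
have T_sym : T = \sum_v \sum_w (m v w)%:R * Num.max (g w ^+ 2 - g v ^+ 2) 0.
  by rewrite /T exchange_big; apply: eq_bigr => v _; apply: eq_bigr => w _; rewrite msym.
have sum_l := sum_edges_source (fun v => g v ^+ 2).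
have sum_r := sum_edges_target (fun v => g v ^+ 2).
have young : 4 * d%:R * h * (T + T) <= h ^+ 2 * (4 * (d%:R * F)) + 4 * d%:R ^+ 2 * E.
  have -> : 4 * (d%:R * F) = \sum_v \sum_w (m v w)%:R * (2 * g v ^+ 2 + 2 * g w ^+ 2).
    transitivity (2 * (d%:R * F) + 2 * (d%:R * F)); first ring.
    rewrite -{1}sum_l -sum_r !mulr_sumr -big_split; apply: eq_bigr => v _ /=.
    by rewrite !mulr_sumr -big_split; apply: eq_bigr => w _ /=; ring.
  rewrite {2}T_sym /T /E -!big_split /= !mulr_sumr -big_split; apply: ler_sum => v _ /=.
  rewrite -!big_split /= !mulr_sumr -big_split; apply: ler_sum => w _ /=.
  set a := g v; set b := g w.
  rewrite -mulrDr !(mulrCA _ (m v w)%:R) -mulrDr ler_wpM2l //.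
  have abE : a ^+ 2 - b ^+ 2 = (a - b) * (a + b) by ring.
  have baE : b ^+ 2 - a ^+ 2 = - ((a - b) * (a + b)) by ring.
  have rhsE : h ^+ 2 * (2 * a ^+ 2 + 2 * b ^+ 2) =
    h ^+ 2 * (a + b) ^+ 2 + h ^+ 2 * (a - b) ^+ 2 by ring.
  have le1 : 0 <= (h * (a + b) - 2 * d%:R * (a - b)) ^+ 2 by apply: sqr_ge0.
  have le2 : 0 <= (h * (a + b) + 2 * d%:R * (a - b)) ^+ 2 by apply: sqr_ge0.
  have le3 : 0 <= h ^+ 2 * (a - b) ^+ 2 by rewrite mulr_ge0 ?sqr_ge0.
  rewrite abE baE rhsE.
  have /orP[ab0|ab0] := le_total 0 ((a - b) * (a + b)).
    by rewrite max_l // max_r ?oppr_le0 // addr0; nra.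
  by rewrite max_r // max_l ?oppr_ge0 // add0r; nra.
have : 4 * d%:R * (h ^+ 2 * F) <= 4 * d%:R * (d%:R * E).
  have hT : d%:R * (h * (h * F)) <= d%:R * (h * T) by rewrite !ler_wpM2l // ltW.
  lra.
by rewrite ler_pM2l // mulr_gt0.
Qed.

(** Both parts of g cut at a median are supported on at most half of the
vertices, and separating the parts does not increase the energy. *)
Lemma cheeger_poincare (g : V -> R) : (0 < d)%N -> (1 < #|V|)%N -> exists c,
  h ^+ 2 * \sum_v (g v - c) ^+ 2 <=
  d%:R * \sum_v \sum_w (m v w)%:R * (g v - g w) ^+ 2.
Proof.
move=> d_gt0 V_gt1; have h_ge0 := vertex_cheeger_ge0 V_gt1.
have [c [c_above c_below]] := exists_median g (ltnW V_gt1).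
exists c; pose p v := Num.max (g v - c) 0; pose q v := Num.max (c - g v) 0.
have p_ge0 v : 0 <= p v by rewrite le_max lexx orbT.
have q_ge0 v : 0 <= q v by rewrite le_max lexx orbT.
have p_supp : [set v | (0 < p v)%R]%SET = [set v | (c < g v)%R]%SET.
  by apply/finset.setP => v; rewrite !inE lt_max ltxx orbF subr_gt0.
have q_supp : [set v | (0 < q v)%R]%SET = [set v | (g v < c)%R]%SET.
  by apply/finset.setP => v; rewrite !inE lt_max ltxx orbF subr_gt0.
have := dirichlet_half_support d_gt0 h_ge0 p_ge0; rewrite p_supp => /(_ c_above) p_le.
have := dirichlet_half_support d_gt0 h_ge0 q_ge0; rewrite q_supp => /(_ c_below) q_le.
have -> : \sum_v (g v - c) ^+ 2 = \sum_v p v ^+ 2 + \sum_v q v ^+ 2.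
  rewrite -big_split; apply: eq_bigr => v _ /=.
  rewrite /p /q -(opprB (g v)).
  by case: (pos_neg_parts_cases (g v - c)) => -[_ [-> ->]]; ring.
rewrite mulrDr (le_trans (lerD p_le q_le)) // -mulrDr ler_wpM2l //.
rewrite -big_split ler_sum // => v _ /=; rewrite -big_split ler_sum // => w _ /=.
rewrite -mulrDr ler_wpM2l // /p /q.
have -> : g v - g w = (g v - c) - (g w - c) by ring.
by rewrite -(opprB (g v)) -(opprB (g w)) sqr_dist_parts_le.
Qed.

(** Singletons are admissible sets, and have at most d neighbours. *)
Lemma vertex_cheeger_le_degree : (1 < #|V|)%N -> h <= d%:R.
Proof.
move=> V_gt1; have /card_gt0P[v _] : (0 < #|V|)%N by rewrite ltnW.
have := @vertex_cheeger_boundary [set v]%SET; rewrite cards1 muln1 => /(_ V_gt1).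
rewrite mulr1 => /le_trans; apply; rewrite ler_nat.
apply: leq_trans (card_vboundary_le _) _; rewrite big_set1 -(mreg v).
by rewrite [leqRHS](bigID (mem (~: [set v])%SET)) leq_addr.
Qed.

(** In a connected graph the boundary of an admissible set is nonempty, so all
the ratios are at least 1/n. *)
Lemma vertex_cheeger_gt0 : (1 < #|V|)%N -> graph_connected m -> 0 < h.
Proof.
move=> V_gt1 conn; have V_gt0 : 0 < #|V|%:R :> R by rewrite ltr0n ltnW.
have adj_sym : connect_sym (adjacent m).
  by apply: sym_connect_sym => v w; rewrite /adjacent msym.
apply: lt_le_trans (_ : #|V|%:R^-1 <= h); first by rewrite invr_gt0.
apply: lb_le_inf => [|_ [A [A0 A_half] <-]].
  have /card_gt0P[v _] : (0 < #|V|)%N by rewrite ltnW.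
  exists (#|vboundary m [set v]%SET|%:R / #|[set v]%SET|%:R), [set v]%SET => //=.
  split; first by apply/set0Pn; exists v; rewrite inE.
  by rewrite cards1 ler_pdivlMr // -natrM ler_nat.
have A_gt0 : 0 < #|A|%:R :> R by rewrite ltr0n card_gt0.
rewrite ler_pdivlMr // mulrC ler_pdivrMr //.
have bd_gt0 : 1 <= #|vboundary m A|%:R :> R.
  rewrite ler1n card_gt0; apply/eqP => bd0.
  have A_closed : closed (adjacent m) A.
    apply: intro_closed => // v w vw vA; apply: contraTT isT => wA.
    have : w \in vboundary m A.
      by rewrite !inE wA; apply/existsP; exists v; rewrite vA.
    by rewrite bd0 finset.in_set0.
  have /set0Pn[v vA] := A0.
  have AT : A = finset.setT.
    apply/finset.setP => w; rewrite finset.in_setT.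
    by rewrite -(closed_connect A_closed (conn v w)).
  by move: A_half; rewrite AT cardsT; lra.
have : #|A|%:R <= #|V|%:R :> R by rewrite ler_nat max_card.
by nra.
Qed.

End Cheeger.

(** * Eigenfunctions *)
Section Eigen.
Variables (R : realType) (V : finType) (m : V -> V -> nat).
Hypothesis msym : forall v w, m v w = m w v.

(** The operator is real and symmetric, so its eigenvalues are real, and the
real or the imaginary part of a complex eigenvector is a real eigenvector. *)
Lemma normalised_adjacency_eigenfunction (d : nat) (lam : R[i]) :
    (0 < d)%N -> eigenvalue (normalised_adjacency m R[i] d) lam ->
  exists x (f : V -> R), [/\ lam = x%:C, exists v, f v != 0 &
    forall v, \sum_w (m v w)%:R * f w = d%:R * x * f v].
Proof.
move=> d_gt0 /eigenvalueP[u u_eig u_neq0].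
have dC : d%:R != 0 :> R[i] by rewrite pnatr_eq0 -lt0n.
pose g v := u ord0 (enum_rank v).
have g_eig v : \sum_w (m v w)%:R * g w = d%:R * lam * g v.
  have := congr1 (fun r : 'rV_#|V| => d%:R * r ord0 (enum_rank v)) u_eig.
  rewrite !mxE mulrA => <-; rewrite mulr_sumr (reindex enum_rank) /=; last first.
    by exists enum_val => i _; rewrite ?enum_rankK ?enum_valK.
  apply: eq_bigr => w _; rewrite !mxE !enum_rankK msym /g.
  by rewrite mulrCA !mulrA mulfK // mulrC.
have [v0 gv0] : exists v, g v != 0.
  move/rV0Pn: u_neq0 => [i ui]; exists (enum_val i).
  by rewrite /g enum_valK.
pose N := \sum_v g v * Num.conj (g v).
have N_gt0 : 0 < N.
  rewrite /N (bigD1 v0) //= ltr_pwDl ?mul_conjC_gt0 // sumr_ge0 // => v _.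
  exact: mul_conjC_ge0.
have lam_real : Num.conj lam = lam.
  pose Q := \sum_v \sum_w (m v w)%:R * (g w * Num.conj (g v)).
  have QE : Q = d%:R * lam * N.
    rewrite mulr_sumr; apply: eq_bigr => v _; rewrite mulrA -g_eig mulr_suml.
    by apply: eq_bigr => w _; rewrite mulrA.
  have Qreal : Num.conj Q = Q.
    rewrite rmorph_sum [RHS]exchange_big; apply: eq_bigr => v _ /=.
    rewrite rmorph_sum; apply: eq_bigr => w _ /=.
    by rewrite !rmorphM /= conjCK conjC_nat (mulrC (Num.conj (g w))) msym.
  have Nreal : Num.conj N = N by apply/CrealP; rewrite realE ltW.
  move: Qreal; rewrite QE !rmorphM /= Nreal conjC_nat.
  by move/(mulIf (lt0r_neq0 N_gt0))/(mulfI dC).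
have /complex_realP[x lamE] : lam \is Num.real by apply/CrealP.
have part_eig (p : R[i] -> R) : {morph p : y z / y + z} -> p 0 = 0 ->
    (forall a z, p (a%:C * z) = a * p z) ->
  forall v, \sum_w (m v w)%:R * p (g w) = d%:R * x * p (g v).
  have dxE : (d%:R * x)%:C = d%:R * lam by rewrite lamE rmorphM rmorph_nat.
  move=> pD p0 pZ v; rewrite -pZ dxE -g_eig (big_morph p pD p0).
  by apply: eq_bigr => w _; rewrite -pZ rmorph_nat.
have [Re0|Re_neq0] := eqVneq (complex.Re (g v0)) 0; last first.
  exists x, (fun v => complex.Re (g v)); split=> //; first by exists v0.
  by apply: part_eig => [[? ?] [? ?]||? [? ?]] //=; rewrite mul0r subr0.
exists x, (fun v => complex.Im (g v)); split=> //.
  exists v0; apply: contraNneq gv0 => Im0.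
  by apply/eqP; case: (g v0) Re0 Im0 => /= ? ? -> ->.
by apply: part_eig => [[? ?] [? ?]||? [? ?]] //=; rewrite mul0r addr0.
Qed.

(** Eigenfunctions of distinct eigenvalues are orthogonal, and the constants are
eigenfunctions for 1. *)
Lemma eigenfunction_sum0 (d : nat) (x : R) (f : V -> R) :
    (0 < d)%N -> (forall v, (\sum_w m v w)%N = d) -> x != 1 ->
    (forall v, \sum_w (m v w)%:R * f w = d%:R * x * f v) ->
  \sum_v f v = 0.
Proof.
move=> d_gt0 mreg x1 f_eig.
have : \sum_v \sum_w (m v w)%:R * f w = d%:R * x * \sum_v f v.
  by rewrite mulr_sumr; apply: eq_bigr => v _; rewrite f_eig.
rewrite exchange_big /=.
under eq_bigr => w _.
  rewrite -mulr_suml -natr_sum; under eq_bigr do rewrite msym.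
  rewrite mreg; over.
rewrite -mulr_sumr -mulrA => /(mulfI _) eq1.
have {}eq1 : \sum_v f v = x * \sum_v f v.
  by apply: eq1; rewrite pnatr_eq0 -lt0n.
apply/eqP; apply: contraNT x1 => sum_neq0.
by apply/eqP/(mulIf sum_neq0); rewrite mul1r.
Qed.

(** Used with c = -1 for the Dirichlet energy of an eigenfunction, and with c = 1
for its failure to alternate along the edges. *)
Lemma sum_edges_sqrD (d : nat) (x : R) (f : V -> R) (c : R) :
    (forall v, (\sum_w m v w)%N = d) ->
    (forall v, \sum_w (m v w)%:R * f w = d%:R * x * f v) ->
  \sum_v \sum_w (m v w)%:R * (f v + c * f w) ^+ 2 =
  d%:R * (1 + c ^+ 2 + 2 * c * x) * \sum_v f v ^+ 2.
Proof.
move=> mreg f_eig.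
have sum_l := sum_edges_source mreg (fun v => f v ^+ 2).
have sum_r := sum_edges_target msym mreg (fun v => f v ^+ 2).
have sum_m : \sum_v \sum_w (m v w)%:R * (f v * f w) = d%:R * x * \sum_v f v ^+ 2.
  rewrite mulr_sumr; apply: eq_bigr => v _; rewrite expr2 mulrA -f_eig mulr_suml.
  by apply: eq_bigr => w _; rewrite mulrA mulrAC.
transitivity (d%:R * (\sum_v f v ^+ 2) + c ^+ 2 * (d%:R * \sum_v f v ^+ 2)
   + 2 * c * (d%:R * x * \sum_v f v ^+ 2)); last by ring.
rewrite -{1}sum_l -sum_r -sum_m !mulr_sumr -!big_split; apply: eq_bigr => v _ /=.
rewrite !mulr_sumr -!big_split; apply: eq_bigr => w _ /=; ring.
Qed.

End Eigen.

(** * Rounding a function of almost constant modulus to a sign *)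
Section SignRounding.
Variables (R : realType) (V : finType) (f : V -> R) (c kappa : R).
Let n := #|V|.
Let F := \sum_v f v ^+ 2.
Let A := [set v | (0 <= f v)%R]%SET.
Hypothesis F_gt0 : 0 < F.
Hypothesis kappa_ge0 : 0 <= kappa.
Hypothesis kappa_small : 2048 * kappa <= 1.
Hypothesis f_flat : \sum_v (`|f v| - c) ^+ 2 <= kappa * F.

Lemma flat_sum_sqr_le : F <= 2 * n%:R * c ^+ 2.
Proof.
have : F <= 3 / 2 * (n%:R * c ^+ 2) + 3 * \sum_v (`|f v| - c) ^+ 2.
  have -> : n%:R * c ^+ 2 = \sum_(v : V) c ^+ 2 by rewrite sumr_const mulr_natl.
  rewrite !mulr_sumr -big_split; apply: ler_sum => v _ /=.
  rewrite -(real_normK (num_real (f v))).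
  by have := sqr_ge0 (`|f v| - 3 / 2 * c); nra.
have : 2048 * kappa * F <= 1 * F by rewrite ler_wpM2r // ltW.
move: F_gt0 f_flat; lra.
Qed.

Lemma flat_level_neq0 : 0 < c ^+ 2.
Proof.
rewrite lt0r sqr_ge0 andbT; apply: contraTneq F_gt0 => c0.
by have := flat_sum_sqr_le; rewrite c0 mulr0 leNgt.
Qed.

(** Where f v and f (p v) have the same sign, one cannot have |f v| and
|f (p v)| close to c and |f v + f (p v)| close to 0 at once: with a = |f v| and
b = |f (p v)|, c^2 <= (a + b)^2 / 2 + (a - c)^2 + (b - c)^2. *)
Lemma card_same_sign_le (p : V -> V) (q : R) : injective p ->
    \sum_v (f v + f (p v)) ^+ 2 <= q * kappa * F -> 0 <= q ->
  #|[set v | (v \in A) == (p v \in A)]%SET|%:R <= (q + 4) * kappa * n%:R.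
Proof.
move=> p_inj fp_le q_ge0; set B := [set v | _]%SET.
have c2 := flat_level_neq0.
suff : c ^+ 2 * #|B|%:R <= (q / 2 + 2) * kappa * F.
  have : (q / 2 + 2) * kappa * F <= (q / 2 + 2) * kappa * (2 * n%:R * c ^+ 2).
    by rewrite ler_wpM2l ?flat_sum_sqr_le // mulr_ge0 // addr_ge0 // divr_ge0.
  by move=> le1 le2; rewrite -(ler_pM2l c2); lra.
have flat_p : \sum_v (`|f (p v)| - c) ^+ 2 = \sum_v (`|f v| - c) ^+ 2.
  by rewrite [RHS](reindex_inj p_inj).
apply: le_trans (_ : 2^-1 * \sum_v (f v + f (p v)) ^+ 2 +
  (\sum_v (`|f v| - c) ^+ 2 + \sum_v (`|f (p v)| - c) ^+ 2) <= _); last first.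
  by rewrite flat_p; move: f_flat; lra.
rewrite mulr_sumr -!big_split /=.
have -> : c ^+ 2 * #|B|%:R = \sum_v (if v \in B then c ^+ 2 else 0).
  by rewrite -big_mkcond sumr_const mulr_natr.
apply: ler_sum => v _; case: ifPn => [|_]; last first.
  by rewrite !addr_ge0 ?sqr_ge0 // mulr_ge0 ?sqr_ge0 ?invr_ge0 ?ler0n.
rewrite !inE => /eqP same.
have sqr_sum : (f v + f (p v)) ^+ 2 = (`|f v| + `|f (p v)|) ^+ 2.
  move: same; have [fv|fv] := leP 0 (f v); have [fpv|fpv] := leP 0 (f (p v)) => // _.
    by rewrite !ger0_norm.
  by rewrite !ltr0_norm // -opprD sqrrN.
rewrite sqr_sum; set x := `|f v|; set y := `|f (p v)|.
have := sqr_ge0 (x + y - c); have := sqr_ge0 (x - y); lra.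
Qed.

(** If f sums to zero then so, nearly, does c times its sign.  The sum
expanded below is that of the squared deviations of [f - c * sg] from its mean
[- c * T / n], multiplied by n^2. *)
Lemma card_nonneg_half : \sum_v f v = 0 ->
  (31 * n <= 64 * #|A|)%N /\ (64 * #|A| <= 33 * n)%N.
Proof.
move=> f_sum0; have c2 := flat_level_neq0; have F_le := flat_sum_sqr_le.
have n_gt0 : 0 < n%:R :> R.
  rewrite ltr0n lt0n; apply: contraTneq F_gt0 => n0.
  by move: F_le; rewrite n0 mulr0 mul0r leNgt.
pose sg v : R := if v \in A then 1 else -1.
pose T := \sum_v sg v.
have TE : T = 2 * #|A|%:R - n%:R.
  rewrite /T (eq_bigr (fun v => 2 * (if v \in A then 1 else 0) - 1)).
    rewrite sumrB -mulr_sumr -big_mkcond !sumr_const /=.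
    by rewrite cardT -cardE.
  by move=> v _; rewrite /sg; case: ifP => _; ring.
have TS : T = \sum_v sg v by [].
clearbody T.
have sg_flat : \sum_v (f v - c * sg v) ^+ 2 <= kappa * F.
  apply: le_trans f_flat; apply: ler_sum => v _; rewrite /sg inE.
  case: ifPn => [f_ge0|]; first by rewrite ger0_norm // mulr1.
  rewrite -ltNge => f_lt0; rewrite ltr0_norm // -(sqrrN (_ - _)).
  by rewrite le_eqVlt (_ : - (f v - c * -1) = - f v - c) ?eqxx //; ring.
have T_le : c ^+ 2 * T ^+ 2 <= n%:R * (kappa * F).
  have : 0 <= \sum_v (n%:R * (f v - c * sg v) + c * T) ^+ 2.
    by apply: sumr_ge0 => v _; apply: sqr_ge0.
  have -> : \sum_v (n%:R * (f v - c * sg v) + c * T) ^+ 2 =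
      n%:R ^+ 2 * (\sum_v (f v - c * sg v) ^+ 2) +
      (2 * n%:R * c * T * (\sum_v f v - c * T) + n%:R * (c * T) ^+ 2).
    have -> : n%:R * (c * T) ^+ 2 = \sum_(v : V) (c * T) ^+ 2.
      by rewrite sumr_const mulr_natl.
    have -> : \sum_v f v - c * T = \sum_v (f v - c * sg v).
      by rewrite TS mulr_sumr sumrB.
    by rewrite !mulr_sumr -!big_split; apply: eq_bigr => v _ /=; ring.
  rewrite f_sum0 => ge0.
  have : 0 <= n%:R * (n%:R * (\sum_v (f v - c * sg v) ^+ 2) - c ^+ 2 * T ^+ 2) by lra.
  rewrite pmulr_rge0 // subr_ge0 => /le_trans; apply.
  by rewrite ler_pM2l.
have {}T_le : T ^+ 2 * 1024 <= n%:R ^+ 2.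
  rewrite -(ler_pM2l c2).
  have : n%:R * (kappa * F) <= n%:R * (kappa * (2 * n%:R * c ^+ 2)).
    by rewrite ler_pM2l // ler_wpM2l.
  have : 2048 * kappa * (n%:R ^+ 2 * c ^+ 2) <= 1 * (n%:R ^+ 2 * c ^+ 2).
    by rewrite ler_wpM2r // mulr_ge0 ?sqr_ge0.
  by lra.
have T_le' : `|T| * 32 <= n%:R.
  rewrite -(@ler_pXn2r _ 2) ?nnegrE ?mulr_ge0 //.
  by rewrite exprMn real_normK ?num_real //; lra.
move: T_le'; rewrite TE => T_le'.
have : `|2 * #|A|%:R - n%:R| <= n%:R / 32 :> R by lra.
rewrite ler_norml => /andP[lo hi].
split; rewrite -(ler_nat R) !natrM; lra.
Qed.

End SignRounding.

(** * Almost invariant sets and their translates *)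
Section Translates.
Variables (gT : finGroupType) (G : {group gT}) (V : finType) (to : action G V).
Implicit Types (A B X Z : {set V}) (x y : gT).

(** The preimage form makes [translate] multiplicative in the order of G, see
[translateM]; it is the translate of [B] by the inverse of [x]. *)
Definition translate x B := [set v | to v x \in B]%SET.
Definition moved x B := [set v | (v \in B) != (to v x \in B)]%SET.

Lemma card_translate x B : #|translate x B| = #|B|.
Proof.
rewrite -(card_preimset B (act_inj to x)).
by apply: eq_card => v; rewrite !inE.
Qed.

Lemma translateM x y B : x \in G -> y \in G ->
  translate x (translate y B) = translate (x * y)%g B.
Proof. by move=> xG yG; apply/finset.setP => v; rewrite !inE actMin. Qed.

Lemma translateI x A B : translate x (A :&: B)%SET = (translate x A :&: translate x B)%SET.
Proof. by apply/finset.setP => v; rewrite !inE. Qed.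

Lemma moved_translate x y B : x \in G -> y \in G ->
  moved x (translate y B) = translate y (moved (x ^ y)%g B).
Proof.
move=> xG yG; apply/finset.setP => v; rewrite !inE.
by rewrite -!actMin ?groupM ?groupV ?groupJ // conjgE mulKVg.
Qed.

Lemma movedI_le x A B : (#|moved x (A :&: B)%SET| <= #|moved x A| + #|moved x B|)%N.
Proof.
apply: leq_trans (leq_card_setU _ _).1; apply/subset_leq_card/fintype.subsetP => v.
by rewrite !inE; do 4!case: (_ \in _).
Qed.

(** If X is almost invariant under S.S, then the union of X with its translate
by y in S is almost invariant under each x in S: x carries X near its translate
(because x y lies in S.S) and the translate near X (because y^-1 x does). *)
Lemma moved_orbitU_le x y X : x \in G -> y \in G ->
  (#|moved x (X :|: translate y X)%SET| <=
   #|moved (x * y)%g X| + #|moved (y^-1 * x)%g X|)%N.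
Proof.
move=> xG yG; rewrite -(card_translate y (moved (y^-1 * x)%g X)).
apply: leq_trans (leq_card_setU _ _).1; apply/subset_leq_card/fintype.subsetP => v.
rewrite !inE -!actMin ?groupM ?groupV // mulKVg.
by do 4!case: (_ \in _).
Qed.

Lemma moved_orbitI_le x y X : x \in G -> y \in G ->
  (#|moved x (X :&: translate y X)%SET| <=
   #|moved (x * y)%g X| + #|moved (y^-1 * x)%g X|)%N.
Proof.
move=> xG yG; rewrite -(card_translate y (moved (y^-1 * x)%g X)).
apply: leq_trans (leq_card_setU _ _).1; apply/subset_leq_card/fintype.subsetP => v.
rewrite !inE -!actMin ?groupM ?groupV // mulKVg.
by do 4!case: (_ \in _).
Qed.

(** A point leaving or entering [B] under [x * y] must keep its side under one
of the two steps: two alternations cancel. *)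
Lemma movedM_same_le x y B : x \in G -> y \in G ->
  (#|moved (x * y)%g B| <= #|~: moved x B|%SET + #|~: moved y B|%SET)%N.
Proof.
move=> xG yG; rewrite -(card_translate x (~: moved y B)%SET).
apply: leq_trans (leq_card_setU _ _).1; apply/subset_leq_card/fintype.subsetP => v.
by rewrite !inE -!actMin ?groupM //; do 3!case: (_ \in _).
Qed.

Variables (S : {set gT}) (A : {set V}) (b : nat).
Hypothesis SG : S \subset G.
Hypothesis Ssym : (S^-1)%g = S.
Hypothesis SSconj : forall x g : gT, x \in (S * S)%g -> g \in G ->
  (g * x * g^-1)%g \in (S * S)%g.
Hypothesis A_alternates : forall s, s \in S -> (#|~: moved s A|%SET <= b)%N.
Hypothesis expansion : forall Z, (forall s, s \in S -> (#|moved s Z| <= 8 * b)%N) ->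
  (50 * #|Z| <= #|V|)%N \/ (50 * #|~: Z|%SET <= #|V|)%N.

(** [X], the intersection of A with a translate, is almost invariant under S.S
because SSconj carries the almost invariance of A over to its translates.  By
expansion the union and the intersection of X with its translate by r in S are
each tiny or almost everything, and their sizes add up to 2|X|. *)
Lemma translate_dichotomy tau : tau \in G -> (0 < #|S|)%N ->
  (50 * #|A :&: translate tau A|%SET <= #|V|)%N \/
  (49 * #|V| <= 100 * #|A :&: translate tau A|%SET)%N.
Proof.
move=> tauG /card_gt0P[r rS]; have inG := fintype.subsetP SG.
have moved_A x : x \in (S * S)%g -> (#|moved x A| <= 2 * b)%N.
  case/mulsgP => s t sS tS ->; rewrite mul2n -addnn.
  by apply: leq_trans (movedM_same_le _ _ _) (leq_add _ _); rewrite ?inG ?A_alternates.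
set X := (A :&: _)%SET.
have moved_X x : x \in (S * S)%g -> (#|moved x X| <= 4 * b)%N.
  move=> xSS; have xG : x \in G.
    by case/mulsgP: xSS => s t /inG sG /inG tG ->; rewrite groupM.
  have xtau : (x ^ tau)%g \in (S * S)%g.
    by rewrite conjgE mulgA -{2}(invgK tau) SSconj ?groupV.
  have := movedI_le x A (translate tau A); rewrite -/X moved_translate // card_translate.
  have := moved_A _ xSS; have := moved_A _ xtau; lia.
have Svr x : x \in S -> (x * r)%g \in (S * S)%g by move=> xS; rewrite mem_mulg.
have Srv x : x \in S -> (r^-1 * x)%g \in (S * S)%g.
  by move=> xS; rewrite mem_mulg // -Ssym inE invgK.
have U_moved s : s \in S -> (#|moved s (X :|: translate r X)%SET| <= 8 * b)%N.
  move=> sS; have := @moved_orbitU_le s r X (inG _ sS) (inG _ rS).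
  have := moved_X _ (Svr _ sS); have := moved_X _ (Srv _ sS); lia.
have I_moved s : s \in S -> (#|moved s (X :&: translate r X)%SET| <= 8 * b)%N.
  move=> sS; have := @moved_orbitI_le s r X (inG _ sS) (inG _ rS).
  have := moved_X _ (Svr _ sS); have := moved_X _ (Srv _ sS); lia.
have cUI : (#|X :|: translate r X|%SET + #|X :&: translate r X|%SET = 2 * #|X|)%N.
  by rewrite cardsUI card_translate mul2n addnn.
have := cardsC (X :|: translate r X)%SET; have := cardsC (X :&: translate r X)%SET.
have IX : (#|X :&: translate r X|%SET <= #|X|)%N.
  exact/subset_leq_card/finset.subsetIl.
by case: (expansion U_moved); case: (expansion I_moved); lia.
Qed.

End Translates.

(** * The subgroup of index two *)
Section IndexTwo.
Variables (gT : finGroupType) (G : {group gT}).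

Lemma index2_mulE (K : {group gT}) x y : K \subset G -> #|G : K|%g = 2%N ->
  x \in G -> y \in G -> (x * y \in K)%g = ((x \in K) == (y \in K)).
Proof.
move=> KG KG2 xG yG.
have [xK|xK] := boolP (x \in K); first by rewrite groupMl.
have [yK|yK] := boolP (y \in K); first by rewrite groupMr // (negPf xK).
have : (x^-1 *: K)%g = (G :\: K)%SET.
  apply/eqP; rewrite eqEcard card_lcoset cardsD (finset.setIidPr KG).
  rewrite -(Lagrange KG) KG2 muln2 -addnn addnK leqnn andbT.
  apply/fintype.subsetP => _ /lcosetP[k kK ->]; rewrite !inE groupMr // groupV xK.
  by rewrite groupM ?groupV // (fintype.subsetP KG).
move/finset.setP/(_ y); rewrite !inE yK yG mem_lcoset invgK => ->.
by [].
Qed.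

Variables (V : finType) (to : action G V) (A : {set V}).
Hypothesis A_half : (31 * #|V| <= 64 * #|A|)%N /\ (64 * #|A| <= 33 * #|V|)%N.
Hypothesis V_gt0 : (0 < #|V|)%N.
Hypothesis dichotomy : forall x, x \in G ->
  (50 * #|A :&: translate to x A|%SET <= #|V|)%N \/
  (49 * #|V| <= 100 * #|A :&: translate to x A|%SET)%N.

Lemma card_setI3_le (P Q T : {set V}) :
  (#|P :&: Q|%SET + #|Q :&: T|%SET <= #|Q| + #|P :&: T|%SET)%N.
Proof.
rewrite -cardsUI leq_add //; apply/subset_leq_card/fintype.subsetP => v; rewrite !inE.
  by case/orP => /andP[].
by case/andP => /andP[-> _] /andP[_ ->].
Qed.

Lemma card_cover3_le (P Q T : {set V}) :
  (#|P| + #|Q| + #|T| <=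
   #|V| + #|P :&: Q|%SET + #|Q :&: T|%SET + #|P :&: T|%SET)%N.
Proof.
have := cardsUI P Q; have := cardsUI (P :|: Q)%SET T.
have : (#|(P :|: Q) :&: T|%SET <= #|P :&: T|%SET + #|Q :&: T|%SET)%N.
  by rewrite finset.setIUl (leq_card_setU _ _).1.
have : (#|P :|: Q :|: T|%SET <= #|V|)%N by exact: max_card.
lia.
Qed.

(** A translate of A is near to A or near to its complement, and this defines a
sign on G.  The thresholds 49/100 and 1/50 leave enough room for the two
counting lemmas above to show that the sign is multiplicative. *)
Lemma translate_index2 (s0 : gT) : s0 \in G ->
    (50 * #|A :&: translate to s0 A|%SET <= #|V|)%N ->
  exists K : {group gT}, [/\ K \subset G, #|G : K|%g = 2%N &
    forall x, x \in G -> (50 * #|A :&: translate to x A|%SET <= #|V|)%N -> x \notin K].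
Proof.
case: A_half => A_lo A_hi s0G s0_far.
pose K := [set x in G | (49 * #|V| <= 100 * #|A :&: translate to x A|%SET)%N]%SET.
have KG : K \subset G by apply/fintype.subsetP => x; rewrite inE => /andP[].
have near x : x \in G -> (x \notin K) = (50 * #|A :&: translate to x A|%SET <= #|V|)%N.
  move=> xG; rewrite inE xG andTb -ltnNge; apply/idP/idP; last by move: V_gt0; lia.
  by move=> x_far; case: (dichotomy xG); lia.
have shift x y : x \in G -> y \in G ->
    #|translate to x A :&: translate to (x * y)%g A|%SET = #|A :&: translate to y A|%SET.
  by move=> xG yG; rewrite -translateM // -translateI card_translate.
have K_group : group_set K.
  apply/group_setP; split=> [|x y xK yK].
    have -> : (1%g \in K) = ~~ (1%g \notin K) by rewrite negbK.
    have A1 : translate to 1%g A = A by apply/finset.setP => v; rewrite !inE act1.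
    by rewrite near ?group1 // A1 finset.setIid; move: V_gt0; lia.
  have [xG yG] := (fintype.subsetP KG _ xK, fintype.subsetP KG _ yK).
  have -> : ((x * y)%g \in K) = ~~ ((x * y)%g \notin K) by rewrite negbK.
  rewrite near ?groupM //.
  have := card_setI3_le A (translate to x A) (translate to (x * y)%g A).
  rewrite shift // card_translate.
  move: xK yK; rewrite !inE => /andP[_ xK] /andP[_ yK]; move: V_gt0; lia.
have far_mul x y : x \in G -> y \in G -> x \notin K -> y \notin K -> (x * y)%g \in K.
  move=> xG yG; rewrite near // near // => x_far y_far.
  have -> : ((x * y)%g \in K) = ~~ ((x * y)%g \notin K) by rewrite negbK.
  rewrite near ?groupM //.
  have := card_cover3_le A (translate to x A) (translate to (x * y)%g A).
  rewrite shift // !card_translate; move: V_gt0; lia.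
have s0K : s0 \notin K by rewrite near.
exists (Group K_group); split=> //; last by move=> x xG x_far; rewrite near.
have coset_s0 : (G :\: K = K :* s0)%g.
  apply/finset.setP => x; rewrite mem_rcoset inE.
  apply/andP/idP => [[xK xG]|xK].
    by rewrite far_mul ?groupV //; rewrite (@groupV _ (Group K_group)).
  have xG : x \in G by rewrite -(mulgKV s0 x) groupM // (fintype.subsetP KG).
  split=> //; apply: contra s0K => x_in.
  have := @groupM _ (Group K_group) _ _ (groupVr (xK : _ \in Group K_group)) x_in.
  by rewrite invMg invgK mulgKV.
have := cardsID K G; rewrite (finset.setIidPr KG) coset_s0 card_rcoset => cG.
have /eqP := Lagrange (KG : Group K_group \subset G).
rewrite -[#|G|]cG addnn -muln2 eqn_pmul2l ?(cardG_gt0 (Group K_group)) //.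
by move/eqP.
Qed.

End IndexTwo.

(** * The multigraph of a group action *)
Section ActionGraph.
Variables (gT : finGroupType) (G : {group gT}) (V : finType) (to : action G V).
Variables (S : {set gT}) (m : V -> V -> nat).
Hypothesis SG : S \subset G.
Hypothesis Ssym : (S^-1)%g = S.
Hypothesis mE : forall v w, m v w = #|[set s in S | w == to v s]%SET|.

Lemma sum_mult (R : nzRingType) (g : V -> R) v :
  \sum_w (m v w)%:R * g w = \sum_(s in S) g (to v s).
Proof.
rewrite (partition_big (to v) xpredT) //=; apply: eq_bigr => w _.
rewrite mE -sum1_card natr_sum mulr_suml.
apply: eq_big => [s|s]; first by rewrite inE eq_sym.
by rewrite inE => /andP[_ /eqP->]; rewrite mul1r.
Qed.

Lemma mult_regular v : (\sum_w m v w)%N = #|S|.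
Proof.
apply/eqP; rewrite -(eqr_nat int) natr_sum.
under eq_bigr do rewrite -[(m _ _)%:R]mulr1.
by rewrite (sum_mult (fun=> 1)) sumr_const.
Qed.

Lemma mult_sym v w : m v w = m w v.
Proof.
rewrite !mE -(card_preimset [set s in S | v == to w s]%SET (@invg_inj gT)).
apply: eq_card => s; rewrite !inE -mem_invg Ssym.
have [sS|//] := boolP (s \in S); have sG := fintype.subsetP SG _ sS.
rewrite /=; apply/eqP/eqP => ->; first by rewrite actKin.
by rewrite actKVin.
Qed.

Lemma card_vboundary_moved (Z : {set V}) b :
    (forall s, s \in S -> (#|moved to s Z| <= b)%N) ->
  (#|vboundary m Z| <= #|S| * b)%N.
Proof.
move=> Z_moved; apply: leq_trans (_ : \sum_(s in S) #|moved to s Z| <= _)%N; last first.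
  by rewrite -sum_nat_const; apply: leq_sum.
have sub : vboundary m Z \subset (\bigcup_(s in S) moved to s Z)%SET.
  apply/fintype.subsetP => w; rewrite !inE => /andP[wZ /existsP[v /andP[vZ]]].
  rewrite /adjacent mE => /card_gt0P[s]; rewrite inE => /andP[sS /eqP wE].
  have sG := fintype.subsetP SG _ sS.
  apply/finset.bigcupP; exists s^-1%g; first by rewrite -Ssym inE invgK.
  by rewrite inE {2}wE actKin // vZ (negPf wZ).
apply: leq_trans (subset_leq_card sub) _.
elim/big_rec2: _ => [|s k B _ IH]; first by rewrite finset.cards0.
by apply: leq_trans (leq_card_setU _ _).1 _; rewrite leq_add2l.
Qed.

End ActionGraph.

(** * The Schreier graph as the graph of an action *)
Section SchreierAction.
Variables (gT : finGroupType) (G H : {group gT}).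
Hypothesis HG : H \subset G.

(** Right multiplication on the cosets.  Elements outside G act trivially, since
the maps of a partial action have to be injective everywhere. *)
Definition sch_act (v : sch_vertex G H) (x : gT) : sch_vertex G H :=
  insubd v (val v :* x)%g.

Lemma val_sch_act v x : x \in G -> val (sch_act v x) = (val v :* x)%g.
Proof.
move=> xG; rewrite val_insubd; case: ifPn => // /negP[].
have /rcosetsP[g gG ->] := valP v.
by apply/rcosetsP; exists (g * x)%g; rewrite ?groupM ?rcosetM.
Qed.

Lemma sch_act_is_action : is_action G sch_act.
Proof.
split=> [x v w | v x y xG yG]; last first.
  by apply: val_inj; rewrite !val_sch_act ?groupM // rcosetM.
have [xG|xG] := boolP (x \in G).
  by move/(congr1 val); rewrite !val_sch_act // => /rcoset_inj/val_inj.
have fixed u : sch_act u x = u.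
  apply: val_inj; rewrite val_insubd; case: ifPn => // /rcosetsP[k kG uxE].
  case/negP: xG; have /rcosetsP[g gG uE] := valP u.
  have : (g * x)%g \in (H :* k)%g.
    by rewrite -uxE uE -rcosetM rcoset_refl.
  case/rcosetP => y yH gxE; rewrite -(mulKg g x) gxE.
  by rewrite groupM ?groupV // groupM // (fintype.subsetP HG).
by rewrite !fixed.
Qed.

Canonical sch_action := Action sch_act_is_action.

Lemma sch_multE (S : {set gT}) v w : S \subset G ->
  sch_mult S v w = #|[set s in S | w == sch_action v s]%SET|.
Proof.
move=> SG; apply: eq_card => s; rewrite !inE.
have [sS|//] := boolP (s \in S); have sG := fintype.subsetP SG _ sS.
by rewrite -(inj_eq val_inj) /= -val_sch_act.
Qed.

Lemma card_sch_vertex : #|{: sch_vertex G H}| = #|G : H|%g.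
Proof. by rewrite card_sig; apply: eq_card. Qed.

(** An element k of H outside K would make K transitive: if x and y are on
opposite sides of K, then y^-1 k x is in K and takes the coset of x to that
of y. *)
Lemma intransitive_index2_sub (K : {group gT}) : K \subset G -> #|G : K|%g = 2%N ->
  ~ acts_transitively G H K -> H \subset K.
Proof.
move=> KG KG2 K_intrans; apply/fintype.subsetP => k kH; apply/negPn/negP => kK.
apply: K_intrans => v w.
have /rcosetsP[x xG vE] := valP v; have /rcosetsP[y yG wE] := valP w.
have kG := fintype.subsetP HG _ kH.
have translate_to k' : k' \in H -> (y^-1 * k' * x)%g \in K ->
    exists2 tau, tau \in K & val w = (val v :* tau^-1)%g.
  move=> k'H tauK; exists (y^-1 * k' * x)%g => //.
  rewrite vE wE -rcosetM !invMg invgK !mulgA mulgV mul1g.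
  by rewrite (rcosetM H) (rcoset_id (groupVr k'H)).
have [xyK|xyK] := boolP ((x \in K) == (y \in K)).
  apply: (translate_to 1%g); rewrite ?group1 // mulg1.
  by rewrite (index2_mulE KG KG2) ?groupV // eq_sym.
apply: (translate_to k) => //.
rewrite !(index2_mulE KG KG2) ?groupM ?groupV // (negPf kK).
by move: xyK; do 2!case: (_ \in K).
Qed.

(** When H lies in K, a coset of H lies in K or avoids it, and a step outside K
exchanges the two cases. *)
Lemma sch_bipartition (K : {group gT}) v s : K \subset G -> #|G : K|%g = 2%N ->
    H \subset K -> s \in G -> s \notin K ->
  (val (sch_action v s) \subset K) = ~~ (val v \subset K).
Proof.
move=> KG KG2 HK sG sK; have /rcosetsP[x xG vE] := valP v.
have subK y : (H :* y \subset K)%g = (y \in K).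
  apply/idP/idP => [/fintype.subsetP|yK]; first by apply; apply: rcoset_refl.
  by rewrite mul_subG // finset.sub1set.
have -> : val (sch_action v s) = (val v :* s)%g by apply: val_sch_act.
rewrite vE -rcosetM !subK (index2_mulE KG KG2) //.
by rewrite (negPf sK); case: (x \in K). 
Qed.

End SchreierAction.

(** * Spectral bounds for the graph of an action *)
Section LowerBound.
Variables (R : realType) (gT : finGroupType) (G : {group gT}) (V : finType).
Variables (to : action G V) (S : {set gT}) (m : V -> V -> nat).
Hypothesis SG : S \subset G.
Hypothesis Ssym : (S^-1)%g = S.
Hypothesis SSconj : forall x g : gT, x \in (S * S)%g -> g \in G ->
  (g * x * g^-1)%g \in (S * S)%g.
Hypothesis mE : forall v w, m v w = #|[set s in S | w == to v s]%SET|.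
Hypothesis V_gt1 : (1 < #|V|)%N.
Hypothesis connected : graph_connected m.

Let d := #|S|.
Let h : R := vertex_cheeger m R.
Let msym := mult_sym SG Ssym mE.
Let mreg := mult_regular mE.

Lemma degree_gt0 : (0 < d)%N.
Proof.
have := lt_le_trans (vertex_cheeger_gt0 R msym V_gt1 connected)
  (vertex_cheeger_le_degree R mreg V_gt1).
by rewrite ltr0n.
Qed.

Let dR : 1 <= d%:R :> R.
Proof. by rewrite ler1n degree_gt0. Qed.
Let h_gt0 : 0 < h := vertex_cheeger_gt0 R msym V_gt1 connected.
Let h_le_d : h <= d%:R := vertex_cheeger_le_degree R mreg V_gt1.

Section Eigenfunction.
Variables (x : R) (f : V -> R).
Hypothesis f_eig : forall v, \sum_w (m v w)%:R * f w = d%:R * x * f v.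
Hypothesis f_neq0 : exists v, f v != 0.
Let F := \sum_v f v ^+ 2.

Lemma eigenfunction_sqr_gt0 : 0 < F.
Proof.
case: f_neq0 => v fv; rewrite /F (bigD1 v) //= ltr_pwDl ?exprn_even_gt0 //.
by apply: sumr_ge0 => w _; apply: sqr_ge0.
Qed.

Lemma cheeger_eigenvalue_le : x != 1 -> x <= 1 - h ^+ 2 / (2 * d%:R ^+ 2).
Proof.
move=> x1; have F_gt0 := eigenfunction_sqr_gt0.
have f_sum0 := eigenfunction_sum0 msym degree_gt0 mreg x1 f_eig.
have [c] := cheeger_poincare msym mreg f degree_gt0 V_gt1.
have := sum_edges_sqrD msym (-1) mreg f_eig.
under eq_bigr do under eq_bigr do rewrite mulN1r.
move=> ->; rewrite -/h -/F => poincare.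
have F_le : F <= \sum_v (f v - c) ^+ 2.
  have -> : \sum_v (f v - c) ^+ 2 = F - 2 * c * (\sum_v f v) + #|V|%:R * c ^+ 2.
    have -> : #|V|%:R * c ^+ 2 = \sum_(v : V) c ^+ 2 by rewrite sumr_const mulr_natl.
    rewrite mulr_sumr -sumrB -big_split; apply: eq_bigr => v _ /=; ring.
  by rewrite f_sum0 mulr0 subr0 lerDl mulr_ge0 ?sqr_ge0.
have le : h ^+ 2 * F <= 2 * d%:R ^+ 2 * (1 - x) * F.
  apply: le_trans (ler_wpM2l (sqr_ge0 h) F_le) (le_trans poincare _).
  by rewrite le_eqVlt; apply/orP; left; apply/eqP; ring.
rewrite lerBrDr addrC -lerBrDr ler_pdivrMr ?mulr_gt0 ?exprn_gt0 ?ltr0n ?degree_gt0 //.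
by rewrite -(ler_pM2r F_gt0); lra.
Qed.

Let kappa := h ^+ 2 / (2048 * d%:R ^+ 6).

(** The energy of |f| is at most the sum over the edges of (f v + f w)^2, that is
2d(1 + x)F, and the Poincare inequality divides this by h^2/d.  The assumed
closeness of x to -1 is what makes the result [kappa] times F. *)
Lemma eigenfunction_flat : x <= -1 + h ^+ 4 / (2 ^+ 12 * d%:R ^+ 8) ->
  exists c, \sum_v (`|f v| - c) ^+ 2 <= kappa * F /\
    (forall s, s \in S -> \sum_v (f v + f (to v s)) ^+ 2 <= d%:R * kappa * F).
Proof.
move=> x_le; have F_gt0 := eigenfunction_sqr_gt0.
have d_gt0 : 0 < d%:R :> R by apply: lt_le_trans dR.
have edge_sum := sum_edges_sqrD msym 1 mreg f_eig.
have [c poincare] := cheeger_poincare msym mreg (fun v => `|f v|) degree_gt0 V_gt1.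
have eps : 2 * d%:R ^+ 2 * (1 + x) <= h ^+ 2 * kappa.
  apply: le_trans (_ : 2 * d%:R ^+ 2 * (h ^+ 4 / (2 ^+ 12 * d%:R ^+ 8)) <= _).
    by rewrite ler_wpM2l ?mulr_ge0 ?sqr_ge0 //; lra.
  rewrite /kappa le_eqVlt; apply/orP; left; apply/eqP; field.
  by rewrite gt_eqF.
have edge_le : d%:R * (2 * d%:R * (1 + x) * F) <= h ^+ 2 * (kappa * F).
  by have := ler_wpM2r (ltW F_gt0) eps; lra.
have edge_eq : \sum_v \sum_w (m v w)%:R * (f v + f w) ^+ 2 = 2 * d%:R * (1 + x) * F.
  transitivity (d%:R * (1 + 1 ^+ 2 + 2 * 1 * x) * F); last by ring.
  rewrite -edge_sum; apply: eq_bigr => v _; apply: eq_bigr => w _; ring.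
exists c; split=> [|s sS].
  rewrite -(ler_pM2l (_ : 0 < h ^+ 2)) ?exprn_gt0 //.
  apply: le_trans poincare (le_trans _ edge_le); rewrite ler_pM2l // -edge_eq.
  apply: ler_sum => v _; apply: ler_sum => w _; rewrite ler_wpM2l //.
  rewrite -[leLHS]real_normK ?num_real // -[leRHS]real_normK ?num_real //.
  rewrite lerXn2r ?nnegrE //.
  by have := ler_dist_dist (f v) (- f w); rewrite normrN opprK.
apply: le_trans (_ : \sum_v \sum_w (m v w)%:R * (f v + f w) ^+ 2 <= _).
  apply: ler_sum => v _; rewrite (sum_mult mE (fun w => (f v + f w) ^+ 2)) (bigD1 s) //=.
  by rewrite lerDl sumr_ge0 // => ? _; apply: sqr_ge0.
rewrite edge_eq -(ler_pM2l d_gt0); apply: le_trans edge_le _.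
have kappaF_ge0 : 0 <= kappa * F.
  by rewrite mulr_ge0 ?divr_ge0 ?sqr_ge0 ?mulr_ge0 ?exprn_ge0 ?ltW.
have h2_le : h ^+ 2 <= d%:R ^+ 2 by rewrite lerXn2r // nnegrE ltW.
by have := ler_wpM2r kappaF_ge0 h2_le; lra.
Qed.

(** It remains to check that the errors fit.  Rounding costs b <= 5 d kappa n
vertices for each s in S.  A set moved by at most 8b has a boundary of at most
8 d b, hence, if it is at most half of the graph, a size of at most
8 d b / h <= 40 n / 2048 < n / 50. *)
Lemma alternating_index2 : x != 1 ->
    x <= -1 + h ^+ 4 / (2 ^+ 12 * d%:R ^+ 8) ->
  exists K : {group gT}, [/\ K \subset G, #|G : K|%g = 2%N &
    forall s, s \in S -> s \notin K].
Proof.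
move=> x1 /eigenfunction_flat[c [f_flat f_alt]]; have F_gt0 := eigenfunction_sqr_gt0.
have d_gt0 : 0 < d%:R :> R by apply: lt_le_trans dR.
have n_gt0 : 0 < #|V|%:R :> R by rewrite ltr0n ltnW.
have f_sum0 := eigenfunction_sum0 msym degree_gt0 mreg x1 f_eig.
have kappa_ge0 : 0 <= kappa by rewrite divr_ge0 ?sqr_ge0 ?mulr_ge0 ?exprn_ge0 ?ltW.
have kappa_h : 2048 * kappa * d%:R ^+ 2 <= h.
  have -> : 2048 * kappa * d%:R ^+ 2 = h ^+ 2 / d%:R ^+ 4.
    by rewrite /kappa; field; rewrite gt_eqF.
  rewrite ler_pdivrMr ?exprn_gt0 // expr2 ler_pM2l //.
  by apply: le_trans h_le_d _; rewrite ler_eXnr.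
have kappa_d : 2048 * kappa * d%:R <= 1.
  by rewrite -(ler_pM2r d_gt0); move: kappa_h h_le_d; lra.
have kappa_small : 2048 * kappa <= 1.
  by apply: le_trans kappa_d; rewrite ler_peMr ?dR // mulr_ge0.
pose A := [set v | (0 <= f v)%R]%SET.
have A_half := card_nonneg_half F_gt0 kappa_ge0 kappa_small f_flat f_sum0.
(* b bounds the number of vertices that some s in S keeps on their side of A. *)
pose b := (\max_(s in S) #|~: moved to s A|%SET)%N.
have A_alt s : s \in S -> (#|~: moved to s A|%SET <= b)%N by move=> sS; apply: leq_bigmax_cond.
have b_le : b%:R <= 5 * d%:R * kappa * #|V|%:R :> R.
  apply: le_trans (_ : (d%:R + 4) * kappa * #|V|%:R <= _); last first.
    by rewrite ler_wpM2r // ler_wpM2r //; move: dR; lra.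
  rewrite /b; elim/big_rec: _ => [|s k sS IH].
    by rewrite mulr_ge0 // mulr_ge0 // addr_ge0.
  rewrite natr_max ge_max IH andbT.
  apply: le_trans (card_same_sign_le F_gt0 kappa_ge0 kappa_small f_flat
    (act_inj to s) (f_alt s sS) (ltW d_gt0)).
  rewrite ler_nat; apply/subset_leq_card/fintype.subsetP => v.
  by rewrite !inE negbK.
have expansion Z : (forall s, s \in S -> (#|moved to s Z| <= 8 * b)%N) ->
    (50 * #|Z| <= #|V|)%N \/ (50 * #|~: Z|%SET <= #|V|)%N.
  have half (Y : {set V}) : (forall s, s \in S -> (#|moved to s Y| <= 8 * b)%N) ->
      (2 * #|Y| <= #|V|)%N -> (50 * #|Y| <= #|V|)%N.
    move=> /(card_vboundary_moved SG Ssym mE) Y_moved /(vertex_cheeger_boundary R m) Y_exp.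
    rewrite -(ler_nat R) natrM -(ler_pM2l h_gt0).
    have : (#|vboundary m Y|)%:R <= d%:R * (8 * b%:R) :> R by rewrite -!natrM ler_nat.
    have := ler_wpM2r (ltW n_gt0) kappa_h.
    have := ler_wpM2l (ltW d_gt0) b_le.
    have := mulr_gt0 h_gt0 n_gt0.
    by move: Y_exp; rewrite -/h; lra.
  move=> Z_moved; have := cardsC Z.
  have [Z_half _|Z_half cZ] := leqP (2 * #|Z|)%N #|V|; [left | right]; apply: half => //.
    by move=> s /Z_moved; rewrite (_ : moved to s (~: Z)%SET = moved to s Z) //;
      apply/finset.setP => v; rewrite !inE; do 2!case: (_ \in _).
  by move: Z_half cZ; clear; lia.
have b_small : (50 * b <= #|V|)%N.
  rewrite -(ler_nat R) natrM.
  have := ler_wpM2r (ltW n_gt0) kappa_d; lra.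
have /card_gt0P[s0 s0S] := degree_gt0.
have far s : s \in S -> (50 * #|A :&: translate to s A|%SET <= #|V|)%N.
  move=> sS; apply: leq_trans b_small; rewrite leq_mul2l /=.
  apply: leq_trans (A_alt s sS); apply/subset_leq_card/fintype.subsetP => v.
  by rewrite !inE; case: (_ <= _)%R; case: (_ <= _)%R.
have dich x' : x' \in G -> (50 * #|A :&: translate to x' A|%SET <= #|V|)%N \/
    (49 * #|V| <= 100 * #|A :&: translate to x' A|%SET)%N.
  by move=> x'G; apply: translate_dichotomy SG Ssym SSconj A_alt expansion _ x'G degree_gt0.
have [K [KG KG2 K_far]] := translate_index2 A_half (ltnW V_gt1) dich
  (fintype.subsetP SG _ s0S) (far s0 s0S).
by exists K; split=> // s sS; apply: K_far; rewrite ?far // (fintype.subsetP SG).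
Qed.

End Eigenfunction.
End LowerBound.

Theorem theorem6p1 (R : realType) (gT : finGroupType) (G H : {group gT})
  (S : {set gT}) (d : nat)
  (HG : H \subset G) (SG : S \subset G)
  (Ssym : (S^-1)%g = S) (cardS : #|S| = d)
  (no_index2 : forall K : {group gT}, K \subset G -> #|G : K|%g = 2%N ->
     ~ acts_transitively G H K)
  (indexH : (4 <= #|G : H|%g)%N)
  (SSconj : forall x g : gT, x \in (S * S)%g -> g \in G ->
     (g * x * g^-1)%g \in (S * S)%g)
  (Sch_connected : graph_connected (@sch_mult gT G H S)) :
  let h : R := vertex_cheeger (@sch_mult gT G H S) R in
  nontrivial_spectrum (normalised_adjacency (@sch_mult gT G H S) R[i] d)
    `<=` [set x%:C | x in
           `](-1 + h ^+ 4 / (2 ^+ 12 * d%:R ^+ 8)),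
             (1 - h ^+ 2 / (2 * d%:R ^+ 2))] ].
Proof.
move=> h lam [lam_eig lam1 lamN1]; rewrite -cardS in lam_eig *.
have mE (v w : sch_vertex G H) : sch_mult S v w = #|[set s in S | w == sch_action HG v s]%SET|.
  exact: sch_multE.
have V_gt1 : (1 < #|{: sch_vertex G H}|)%N by rewrite card_sch_vertex; apply: leq_trans indexH.
have msym := mult_sym SG Ssym mE.
have d_gt0 := degree_gt0 R SG Ssym mE V_gt1 Sch_connected.
have [x [f [lamE f_neq0 f_eig]]] := normalised_adjacency_eigenfunction msym d_gt0 lam_eig.
have x1 : x != 1 by apply: contraNneq lam1 => x1; rewrite lamE x1.
have xN1 : - x != 1.
  by rewrite eqr_oppLR; apply: contraNneq lamN1 => xN1; rewrite lamE xN1 rmorphN1.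
exists x => //; rewrite /= in_itv /=; apply/andP; split; last first.
  exact (cheeger_eigenvalue_le SG Ssym mE V_gt1 Sch_connected f_eig f_neq0 x1).
rewrite ltNge; apply/negP => x_le.
have [K [KG KG2 SK]] :=
  alternating_index2 SG Ssym SSconj mE V_gt1 Sch_connected f_eig f_neq0 x1 x_le.
have HK := intransitive_index2_sub HG KG KG2 (no_index2 K KG KG2).
(* chi is the sign of the bipartition, so chi * f has eigenvalue -x. *)
pose chi (v : sch_vertex G H) : R := if val v \subset K then 1 else -1.
have chi_eig v : \sum_w (sch_mult S v w)%:R * (chi w * f w) =
    #|S|%:R * - x * (chi v * f v).
  have -> : #|S|%:R * - x * (chi v * f v) = - (chi v * (#|S|%:R * x * f v)) by ring.
  rewrite -f_eig !(sum_mult mE) mulr_sumr -sumrN.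
  apply: eq_bigr => s sS; rewrite /chi.
  rewrite (sch_bipartition HG v KG KG2 HK (fintype.subsetP SG _ sS) (SK s sS)).
  by case: (_ \subset _); rewrite ?mulN1r ?mul1r ?opprK.
have chi_neq0 : exists v, chi v * f v != 0.
  by case: f_neq0 => v fv; exists v; rewrite mulf_neq0 // /chi; case: ifP; rewrite ?oppr_eq0 oner_eq0.
have := cheeger_eigenvalue_le SG Ssym mE V_gt1 Sch_connected chi_eig chi_neq0 xN1.
have h_gt0 := vertex_cheeger_gt0 R msym V_gt1 Sch_connected.
have h_le := vertex_cheeger_le_degree R (mult_regular mE) V_gt1.
rewrite -/h in x_le h_gt0 h_le *; set e := #|S|%:R in x_le h_le *.
have e_ge1 : 1 <= e by rewrite ler1n.
have e_gt0 : 0 < e by apply: lt_le_trans e_ge1.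
(* With u = (h/d)^2 <= 1, the claim compares u/2 with u^2 / (2^12 d^4). *)
pose u := h ^+ 2 / e ^+ 2.
have u_gt0 : 0 < u by rewrite divr_gt0 ?exprn_gt0.
have u_le1 : u <= 1 by rewrite ler_pdivrMr ?exprn_gt0 // mul1r lerXn2r // nnegrE ltW.
have -> : h ^+ 2 / (2 * e ^+ 2) = u / 2 by rewrite /u; field; rewrite gt_eqF.
have : h ^+ 4 / (2 ^+ 12 * e ^+ 8) <= u / 4096.
  have -> : h ^+ 4 / (2 ^+ 12 * e ^+ 8) = u ^+ 2 / 4096 / e ^+ 4.
    by rewrite /u; field; rewrite gt_eqF.
  rewrite ler_pdivrMr ?exprn_gt0 //.
  have : 1 <= e ^+ 4 by apply: exprn_ege1.
  by nra.
by move: x_le; lra.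
Qed.
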